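(* Let $A$ be a Fréchet space of sequences as in the context, with topology given by an increasing sequence of seminorms $(p_n)_{n\ge1}$, let $X$ be a separable topological vector space whose topology is given by an increasing sequence of seminorms $(q_j)_{j\ge1}$, let $(x_n)_{n\ge0}$ be a sequence in $X$, and let $\mathcal{U}_A$ be the associated set of restricted universal series. Suppose that $X$ possesses a continuous norm and that for any $n\ge1$, $\ker p_n$ is a subspace of finite codimension of $A$. Then $\mathcal{U}_A$ is spaceable if and only if for any $N\ge1$ and any $\varepsilon>0$, the set $$\bigcup_{L>M\ge N}\left(\Big\{\sum_{k=N}^Ma_kx_k:p_N\Big(\sum_{k=N}^Ma_ke_k\Big)<\varepsilon\Big\}\cap\Big\{\sum_{k=M+1}^La_kx_k:p_N\Big(\sum_{k=M+1}^La_ke_k\Big)<\varepsilon\Big\}\right)$$ (where in each of the two sets the $a_k$ range over all scalars in $\mathbb{K}$ satisfying the indicated condition) is dense in $X$.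
   Context: $\mathbb{K}=\mathbb{R}$ or $\mathbb{C}$. $A$ is a Fréchet space that is a subspace of $\mathbb{K}^{\mathbb{Z}_+}$ (sequences indexed by non-negative integers) such that the coordinate projections $A\to\mathbb{K}$, $(a_n)_{n\ge0}\mapsto a_m$, are continuous for all $m\ge0$ and such that the set of polynomials (finitely supported sequences) is contained and dense in $A$. $(e_n)_{n\ge0}$ is the canonical basis of $\mathbb{K}^{\mathbb{Z}_+}$. Define $S_k:A\to X$ by $S_k((a_n)_{n\ge0})=\sum_{n=0}^ka_nx_n$ and $S^A_k:A\to A$ by $S^A_k((a_n)_{n\ge0})=\sum_{n=0}^ka_ne_n$. A sequence $a\in A$ is a restricted universal series if for every $x\in X$ there exists an increasing sequence $(n_k)$ of positive integers such that $S_{n_k}a\to x$ in $X$ and $S^A_{n_k}a\to a$ in $A$ as $k\to\infty$. $\mathcal{U}_A$ is the set of restricted universal series; it is spaceable if $\mathcal{U}_A\cup\{0\}$ contains a closed infinite-dimensional subspace of $A$. *)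

(* Defs.v *)
From HB Require Import structures.
From mathcomp Require Import all_boot all_order all_algebra.
From mathcomp Require Import all_classical all_reals all_analysis.
From mathcomp Require Import complex.
Set Implicit Arguments.
Unset Strict Implicit.
Unset Printing Implicit Defensive.
Import Order.TTheory GRing.Theory Num.Theory.

Local Open Scope classical_set_scope.
Local Open Scope ring_scope.

Variant real_or_complex (R : realType) : numFieldType -> Prop :=
| Scalars_real : real_or_complex R (R : numFieldType)
| Scalars_complex : real_or_complex R (complex R : numFieldType).

Definition lin_span (K : numFieldType) (V : lmodType K) (m : nat)
    (v : 'I_m -> V) : set V :=
  range (fun c : 'I_m -> K => \sum_i c i *: v i).

Definition finite_dim (K : numFieldType) (V : lmodType K) (W : set V) : Prop :=
  exists (m : nat) (v : 'I_m -> V), W = lin_span v.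

(* W + span(v_1, .., v_m) = V, i.e. V / W is spanned by the classes of the v_i *)
Definition finite_codim (K : numFieldType) (V : lmodType K) (W : set V) : Prop :=
  exists (m : nat) (v : 'I_m -> V),
    forall x : V, exists2 w, W w & lin_span v (x - w).

(* As for norms in the library, the values are in K; when K is the field of
   complex numbers, 0 <= z and z < e include that these numbers are real. *)
Record seminorm (K : numFieldType) (V : lmodType K) (p : V -> K) : Prop := {
  seminorm_ge0 : forall x, 0 <= p x ;
  seminormZ : forall (c : K) x, p (c *: x) = `|c| * p x ;
  seminormD : forall x y, p (x + y) <= p x + p y }.

(* The sequences are indexed by n >= 1: p 0 is unconstrained and never used. *)
Record increasing_seminorms_topology (K : numFieldType)
    (V : topologicalLmodType K) (p : nat -> V -> K) : Prop := {
  ist_seminorm : forall n, (1 <= n)%N -> seminorm (p n) ;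
  ist_le : forall n x, (1 <= n)%N -> p n x <= p n.+1 x ;
  ist_nbhs : forall (x : V) (U : set V), nbhs x U <->
    exists (n : nat) (e : K),
      [/\ (1 <= n)%N, 0 < e & [set y | p n (y - x) < e] `<=` U] }.

Definition has_continuous_norm (K : numFieldType) (V : topologicalLmodType K) :
    Prop :=
  exists nu : V -> K, [/\ seminorm nu, (forall x, nu x = 0 -> x = 0)
    & continuous (nu : V -> K^o)].

Definition separable_space (T : topologicalType) : Prop :=
  exists2 D : set T, countable D & dense D.

(* Every Cauchy filter for the translation-invariant uniformity converges.  The
   completeness of uniform spaces is not used here because the uniformity of a
   tvsType is only required to induce its topology. *)
Definition complete_tvs (K : numFieldType) (V : topologicalLmodType K) : Prop :=
  forall F : set_system V, ProperFilter F ->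
    (fun xy : V * V => xy.1 - xy.2) @ (F, F) --> (0 : V) ->
    exists l : V, F --> l.

Record frechet_space (K : numFieldType) (V : topologicalLmodType K) : Prop := {
  frechet_hausdorff : hausdorff_space V ;
  frechet_seminorms : exists p, @increasing_seminorms_topology K V p ;
  frechet_complete : complete_tvs V }.

(* A is a subspace of K^nat through the linear injection iota, and e n is the
   element of A whose image is the n-th canonical basis vector; the presence of
   the e n amounts to the inclusion of the polynomials in A. *)
Record frechet_sequence_space (K : numFieldType) (A : topologicalLmodType K)
    (iota : {linear A -> (nat -> K^o)}) (e : nat -> A) : Prop := {
  fss_frechet : frechet_space A ;
  fss_inj : injective iota ;
  fss_coord : forall m, continuous (fun a : A => iota a m : K^o) ;
  fss_basis : forall n m, iota (e n) m = (m == n)%:R ;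
  fss_dense : dense
    [set a : A | exists N, forall n, (N <= n)%N -> iota a n = 0] }.

Definition partial_sum (K : numFieldType) (V : lmodType K) (x : nat -> V)
    (k : nat) (a : nat -> K) : V :=
  \sum_(0 <= n < k.+1) a n *: x n.

Definition restricted_universal (K : numFieldType)
    (A X : topologicalLmodType K) (iota : A -> nat -> K) (e : nat -> A)
    (x : nat -> X) : set A :=
  [set a | forall y : X, exists nk : nat -> nat,
    [/\ forall k, (1 <= nk k)%N,
        {homo nk : i j / (i < j)%N},
        partial_sum x (nk k) (iota a) @[k --> \oo] --> y
      & partial_sum e (nk k) (iota a) @[k --> \oo] --> a]].

Definition spaceable (K : numFieldType) (A : topologicalLmodType K)
    (U : set A) : Prop :=
  exists W : set A, [/\ GRing.submod_closed [in W], closed W,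
    ~ finite_dim W & W `<=` U `|` [set 0]].

Definition block_sums (K : numFieldType) (A X : lmodType K) (e : nat -> A)
    (x : nat -> X) (p : A -> K) (eps : K) (i j : nat) : set X :=
  [set \sum_(i <= k < j.+1) a k *: x k | a in
    [set a : nat -> K | p (\sum_(i <= k < j.+1) a k *: e k) < eps]].

(* Main.v *)
Require Import Defs.
From HB Require Import structures.
From mathcomp Require Import all_boot all_order all_algebra.
From mathcomp Require Import all_classical all_reals all_analysis.
From mathcomp Require Import complex.
Set Implicit Arguments.
Unset Strict Implicit.
Unset Printing Implicit Defensive.
Import Order.TTheory GRing.Theory Num.Theory.

Local Open Scope classical_set_scope.
Local Open Scope ring_scope.

(** Finite codimension of all the kernels forces [A] to be the space of all
    scalar sequences with the topology of coordinatewise convergence: each [p n]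
    vanishes on every sequence whose first coordinates, up to some rank
    depending on [n], are zero ([ker_tail]), and every scalar sequence belongs
    to [A] ([coord_surj]).  Partial sums in [A] then always converge, so that
    being a restricted universal series only means that the partial sums
    [S_n a] in [X] visit every neighbourhood of every point infinitely often.
    Likewise the constraint on [p N] in the density condition can be met for
    free by letting the blocks act on late coordinates only; what the condition
    really says is that arbitrarily late blocks can move a partial sum away
    from [0], close to any prescribed point, and then exactly back to [0].

    Density gives spaceability ([interleaved_blocks]): consecutive blocks of
    indices, each of which brings the partial sums from [0] close to a target
    and back to [0], are distributed among countably many owners, in such a way
    that every owner meets every target infinitely often.  If [b] is the
    sequence so built, the closed subspace of all sequences
    [c (own n) * b n], with [c] arbitrary, consists of universal series and [0]:
    at each time at most one block is active, so coefficients of the other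
    owners do not interfere, whatever their size.

    Spaceability gives density ([recurrent_zero_partial_sums]): a closed
    infinite-dimensional [W] contains a nonzero [f], with as many leading zero
    coordinates as desired, whose partial sums vanish infinitely often.
    Otherwise one takes elements of [W] with later and later supports whose
    partial sums are eventually nonzero, and since any infinite combination of
    them is an element of [W], coefficients growing fast enough keep the partial
    sums of such a combination away from [0] for the continuous norm of [X],
    contradicting universality.  For this [f], which is universal, some
    [S_M f] lies in the given open set and some later [S_L f] is [0], so that
    [S_M f] is also minus the block of [f] between [M + 1] and [L]. *)

(** * Linear subspaces *)

(** The notion of [GRing.submod_closed], for membership in a set instead of a
    boolean predicate. *)
Definition linear_subspace (K : numFieldType) (V : lmodType K) (W : set V) :=
  W 0 /\ forall c u v, W u -> W v -> W (c *: u + v).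

Lemma submod_closedP (K : numFieldType) (V : lmodType K) (W : set V) :
  GRing.submod_closed [in W] <-> linear_subspace W.
Proof.
split=> -[W0 WD]; split.
- by move: W0; rewrite in_setE.
- by move=> c u v Wu Wv; have := WD c u v; rewrite !in_setE; apply.
- by rewrite in_setE.
- by move=> c u v; rewrite !in_setE; apply: WD.
Qed.

Section Subspaces.
Variables (K : numFieldType) (V : lmodType K) (W : set V).
Hypothesis Wsub : linear_subspace W.

Lemma subspaceZ c u : W u -> W (c *: u).
Proof. by move=> Wu; rewrite -[_ *: _]addr0; apply: Wsub.2 => //; case: Wsub. Qed.

Lemma subspaceD u v : W u -> W v -> W (u + v).
Proof. by move=> Wu Wv; rewrite -[u]scale1r; apply: Wsub.2. Qed.

Lemma subspaceB u v : W u -> W v -> W (u - v).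
Proof.
by move=> Wu Wv; rewrite -[- v]scaleN1r; apply: subspaceD => //; apply: subspaceZ.
Qed.

End Subspaces.

Lemma subspaceI (K : numFieldType) (V : lmodType K) (W W' : set V) :
  linear_subspace W -> linear_subspace W' -> linear_subspace (W `&` W').
Proof.
move=> [W0 WD] [W'0 W'D]; split=> // c u v [? ?] [? ?].
by split; [apply: WD|apply: W'D].
Qed.

Lemma subspace_add_line (K : numFieldType) (V : lmodType K) (T : set V) (v : V) :
  linear_subspace T -> linear_subspace [set z | exists c, T (z - c *: v)].
Proof.
move=> [T0 TD]; split; first by exists 0; rewrite scale0r subrr.
move=> c y z [a Ta] [b Tb]; exists (c * a + b).
rewrite (_ : _ - _ = c *: (y - a *: v) + (z - b *: v)); first exact: TD.
by rewrite scalerDl scalerBr scalerA opprD addrACA.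
Qed.

(** Descending chain condition modulo a subspace [T] of finite codimension.
    The dimension of [U 0] modulo [T] is bounded by [d]; adding one vector [v]
    to [T], induction settles the chain modulo [T + K v], and the remaining
    line either eventually meets no [U m] outside [T], or is absorbed by all of
    them. *)
Lemma subspace_chain_stationary (K : numFieldType) (V : lmodType K)
    (T : set V) (U : nat -> set V) (d : nat) (v : 'I_d -> V) :
  linear_subspace T -> (forall m, linear_subspace (U m)) ->
  (forall m m', (m <= m')%N -> U m' `<=` U m) ->
  (forall z, U 0%N z -> exists2 w, T w & lin_span v (z - w)) ->
  exists m0, forall m z, U m0 z -> exists2 u, U m u & T (z - u).
Proof.
move=> Tsub Usub Udec; elim: d v T Tsub => [|d IH] v T Tsub span.
  exists 0%N => m z /span[w Tw [c _]]; rewrite big_ord0 => /esym/eqP.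
  rewrite subr_eq0 => /eqP ->; exists 0; first by case: (Usub m).
  by rewrite subr0.
have T'sub := subspace_add_line (v ord0) Tsub.
have [z /span[w Tw [c _ cE]]|m1 m1P] := IH (fun i => v (lift ord0 i)) _ T'sub.
  exists (w + c ord0 *: v ord0); first by exists (c ord0); rewrite addrK.
  exists (fun i => c (lift ord0 i)) => //.
  by rewrite opprD addrA -cE big_ord_recl addrC addKr.
have [[m2 m2P]|noex] := pselect (exists m2, forall z,
    U m2 z -> (exists c, T (z - c *: v ord0)) -> T z).
  exists (maxn m1 m2) => m z Uz.
  have [u Uu T'zu] := m1P (maxn m m2) z (Udec _ _ (leq_maxl _ _) _ Uz).
  exists u; first by apply: Udec Uu; rewrite leq_maxl.
  apply: m2P T'zu.
  by apply: subspaceB => //; [apply: Udec Uz|apply: Udec Uu]; rewrite leq_maxr.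
exists m1 => m z Uz; have [u Uu [c' Tc']] := m1P m z Uz.
(* Every [U m] contains some [y] that represents the line modulo [T]. *)
have [y [Uy [c Tc] nTy]] : exists y,
    [/\ U m y, exists c, T (y - c *: v ord0) & ~ T y].
  apply: contrapT => nex; apply: noex; exists m => y Uy T'y.
  by apply: contrapT => nTy; apply: nex; exists y.
have c0 : c != 0.
  by apply: contra_notN nTy => /eqP c0; move: Tc; rewrite c0 scale0r subr0.
exists ((c' / c) *: y + u); first by apply: (Usub m).2.
rewrite (_ : _ - _ = (z - u - c' *: v ord0) - (c' / c) *: (y - c *: v ord0)).
  by apply: subspaceB => //; apply: subspaceZ.
rewrite scalerBr scalerA divfK // opprB addrA subrK opprD addrA.
by rewrite [LHS]addrAC.
Qed.

(** * Topologies defined by increasing seminorms *)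

Section Seminorms.
Variables (K : numFieldType) (V : lmodType K) (p : V -> K).
Hypothesis sp : seminorm p.

Lemma seminorm0 : p 0 = 0.
Proof. by rewrite -[0](scale0r (0 : V)) (seminormZ sp) normr0 mul0r. Qed.

Lemma seminormN u : p (- u) = p u.
Proof. by rewrite -scaleN1r (seminormZ sp) normrN1 mul1r. Qed.

Lemma seminorm_distC u v : p (u - v) = p (v - u).
Proof. by rewrite -opprB seminormN. Qed.

Lemma seminorm_le0 u : p u <= 0 -> p u = 0.
Proof. by move=> pu; apply/eqP; rewrite eq_le pu (seminorm_ge0 sp). Qed.

(** The order of [K] may be partial, but [p u] is comparable to [0]. *)
Lemma seminorm_lt_all u : (forall e, 0 < e -> p u < e) -> p u = 0.
Proof.
move=> small; apply: contrapT => /eqP pu0.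
by have := small (p u); rewrite ltxx lt_def pu0 (seminorm_ge0 sp) => /(_ isT).
Qed.

Lemma seminorm_ker_subspace : linear_subspace [set u | p u = 0].
Proof.
split=> [|c u v pu pv] /=; first exact: seminorm0.
apply: seminorm_le0; apply: (le_trans (seminormD sp _ _)).
by rewrite (seminormZ sp) pu pv mulr0 addr0.
Qed.

Lemma seminorm_dist_triangle w u v : p (u - v) <= p (u - w) + p (w - v).
Proof. by rewrite -[u - v](subrKA w); apply: (seminormD sp). Qed.

End Seminorms.

Section SeminormTopology.
Variables (K : numFieldType) (V : topologicalLmodType K) (p : nat -> V -> K).
Hypothesis hp : increasing_seminorms_topology p.

Lemma ist_homo m n u : (1 <= m)%N -> (m <= n)%N -> p m u <= p n u.
Proof.
move=> m1; elim: n => [|n IH]; first by rewrite leqn0 => /eqP ->.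
rewrite leq_eqVlt => /predU1P[->//|]; rewrite ltnS => mn.
by apply: (le_trans (IH mn)); apply: (ist_le hp); apply: leq_trans mn.
Qed.

Lemma ist_ker m n u : (1 <= m)%N -> (m <= n)%N -> p n u = 0 -> p m u = 0.
Proof.
move=> m1 mn pn; apply: (seminorm_le0 (ist_seminorm hp m1)).
by rewrite -pn; apply: ist_homo.
Qed.

Lemma ist_cvgP (u : nat -> V) (l : V) : u @ \oo --> l <->
  forall n e, (1 <= n)%N -> 0 < e ->
    exists k0, forall k, (k0 <= k)%N -> p n (u k - l) < e.
Proof.
split=> [ul n e n1 e0|small U /(ist_nbhs hp)[n [e [n1 e0 sub]]]].
  have : nbhs l [set y | p n (y - l) < e] by apply/(ist_nbhs hp); exists n, e; split.
  by move=> nb; have [k0 _ k0P] := ul _ nb; exists k0 => k /k0P.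
have [k0 k0P] := small n e n1 e0.
by exists k0 => // k /k0P; apply: sub.
Qed.

(** A sequence whose increments are killed by seminorms of increasing index is
    Cauchy, and its limit agrees with its [j]-th term exactly, not merely
    approximately, as far as [p j] can see. *)
Lemma complete_ker_limit (u : nat -> V) (n : nat) : complete_tvs V -> (1 <= n)%N ->
  (forall j, (n <= j)%N -> p j (u j.+1 - u j) = 0) ->
  exists l, forall j, (n <= j)%N -> p j (l - u j) = 0.
Proof.
move=> cplt n1 step.
have far j k : (n <= j)%N -> (j <= k)%N -> p j (u k - u j) = 0.
  move=> nj /subnKC <-; have j1 := leq_trans n1 nj; have sp := ist_seminorm hp j1.
  elim: (k - j)%N => [|i IH]; first by rewrite addn0 subrr (seminorm0 sp).
  rewrite addnS -[_ - _](subrKA (u (j + i)%N)).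
  apply: (subspaceD (seminorm_ker_subspace sp)) => //=.
  apply: (ist_ker j1 (leq_addr i j)); apply: step.
  by apply: leq_trans nj (leq_addr _ _).
have [|l ul] := cplt (u @ \oo) _.
  move=> U /(ist_nbhs hp)[m [e [m1 e0 sub]]].
  pose j := maxn m n.
  exists (u @` [set k | (j <= k)%N], u @` [set k | (j <= k)%N]).
    by split; exists j => // k jk; exists k.
  move=> [_ _] [/= [i ji <-] [k jk <-]]; apply: sub => /=; rewrite subr0.
  have j1 : (1 <= j)%N by rewrite leq_max m1.
  suff -> : p m (u i - u k) = 0 by [].
  apply: (@ist_ker _ j) => //; first exact: leq_maxl.
  have -> : u i - u k = (u i - u j) - (u k - u j) by rewrite opprB addrA subrK.
  apply: (subspaceB (seminorm_ker_subspace (ist_seminorm hp j1))).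
    by apply: far => //; apply: leq_maxr.
  by apply: far => //; apply: leq_maxr.
exists l => j nj; have j1 := leq_trans n1 nj; have sp := ist_seminorm hp j1.
apply: (seminorm_lt_all sp) => e e0.
have [k0 /(_ (maxn k0 j) (leq_maxl _ _)) lt] := (ist_cvgP u l).1 ul j e j1 e0.
apply: (le_lt_trans (seminorm_dist_triangle sp (u (maxn k0 j)) _ _)).
by rewrite (far _ _ nj (leq_maxr _ _)) addr0 (seminorm_distC sp).
Qed.

End SeminormTopology.

(** * Sequence spaces and their coordinates *)

Section Coordinates.
Variables (K : numFieldType) (A : lmodType K) (iota : {linear A -> (nat -> K^o)}).

Definition tail_space (m : nat) : set A :=
  [set a | forall k, (k < m)%N -> iota a k = 0].

Lemma coordP c u v k : iota (c *: u + v) k = c * iota u k + iota v k.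
Proof. by rewrite linearP. Qed.

Lemma coordZ c u k : iota (c *: u) k = c * iota u k.
Proof. by rewrite linearZ. Qed.

Lemma coordB u v k : iota (u - v) k = iota u k - iota v k.
Proof. by rewrite linearB. Qed.

Lemma coord0 k : iota 0 k = 0.
Proof. by rewrite linear0. Qed.

Lemma coord_sum I (r : seq I) (F : I -> A) k :
  iota (\sum_(i <- r) F i) k = \sum_(i <- r) iota (F i) k.
Proof. by rewrite linear_sum fct_sumE. Qed.

Lemma tail_subspace m : linear_subspace (tail_space m).
Proof.
split=> [k _|c u v u0 v0 k km]; first exact: coord0.
by rewrite coordP u0 // v0 // mulr0 addr0.
Qed.

Lemma tail_homo m m' : (m <= m')%N -> tail_space m' `<=` tail_space m.
Proof. by move=> mm a a0 k km; apply: a0; apply: leq_trans mm. Qed.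

Hypothesis iota_inj : injective iota.

Lemma coord_inj a b : (forall k, iota a k = iota b k) -> a = b.
Proof. by move=> ab; apply: iota_inj; apply/funext. Qed.

(** For the direct implication the decreasing subspaces [W `&` tail_space m],
    which have intersection [0], must be stationary.  Conversely [m] coordinates
    then separate the points of [W]. *)
Lemma finite_dim_tailP (W : set A) : linear_subspace W ->
  finite_dim W <-> exists m, W `&` tail_space m `<=` [set 0].
Proof.
move=> Wsub; split=> [[d [v WE]]|[m]].
  have [| | | z [Wz _]|m mP] := @subspace_chain_stationary K A [set 0]
      (fun m => W `&` tail_space m) d v.
  - by split=> // c u w -> ->; rewrite scaler0 addr0.
  - by move=> m; apply: subspaceI => //; apply: tail_subspace.
  - by move=> m m' mm z [Wz tz]; split=> //; apply: tail_homo tz.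
  - by exists 0 => //; rewrite subr0 -WE.
  exists m => z Uz; apply: coord_inj => k; rewrite coord0.
  have [u [_ ut] /= /eqP] := mP k.+1 z Uz.
  by rewrite subr_eq0 => /eqP ->; apply: ut.
elim: m W Wsub => [|m IH] W Wsub W0.
  exists 0%N, (fun=> 0); rewrite eqEsubset; split=> z.
    by move=> Wz; exists (fun=> 0) => //; rewrite big_ord0; apply/esym/W0.
  by move=> [c _ <-]; rewrite big_ord0; case: Wsub.
have hyp_sub : linear_subspace [set a | iota a m = 0].
  split=> [|c u v /= u0 v0] /=; first exact: coord0.
  by rewrite coordP u0 v0 mulr0 addr0.
have [|d [v WE]] := IH (W `&` [set a | iota a m = 0]) (subspaceI Wsub hyp_sub).
  move=> z [[Wz zm] zt]; apply: W0; split=> // k.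
  by rewrite ltnS leq_eqVlt => /predU1P[->//|]; apply: zt.
have [Wm|] := pselect (W `<=` [set a | iota a m = 0]).
  by exists d, v; rewrite -WE; apply/esym/setIidPl.
move=> /existsNP[u /not_implyP[Wu /eqP um]].
exists d.+1, (fun i => if unlift ord0 i is Some j then v j else u).
have spanE (c : 'I_d.+1 -> K) :
    \sum_i c i *: (if unlift ord0 i is Some j then v j else u) =
    c ord0 *: u + \sum_(i < d) c (lift ord0 i) *: v i.
  by rewrite big_ord_recl unlift_none; under eq_bigr do rewrite liftK.
rewrite eqEsubset; split=> z.
  move=> Wz; pose a := iota z m / iota u m.
  have : (W `&` [set a | iota a m = 0]) (z - a *: u).
    split; first by apply: subspaceB => //; apply: subspaceZ.
    by rewrite /= coordB coordZ divfK // subrr.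
  rewrite WE => -[c _ cE].
  exists (fun i => if unlift ord0 i is Some j then c j else a) => //.
  rewrite spanE unlift_none; under eq_bigr do rewrite liftK.
  by rewrite cE addrC subrK.
move=> [c _ <-]; rewrite spanE; apply: Wsub.2 => //.
suff [] : (W `&` [set a | iota a m = 0]) (\sum_(i < d) c (lift ord0 i) *: v i) by [].
by rewrite WE; exists (fun i => c (lift ord0 i)).
Qed.

End Coordinates.

(** * Kernels of finite codimension: all sequences, coordinatewise topology *)

Section AllSequences.
Variables (K : numFieldType) (A : topologicalLmodType K).
Variables (iota : {linear A -> (nat -> K^o)}) (e : nat -> A).
Hypothesis hA : frechet_sequence_space iota e.
Variable p : nat -> A -> K.
Hypothesis hp : increasing_seminorms_topology p.
Hypothesis hker : forall n, (1 <= n)%N -> finite_codim [set a : A | p n a = 0].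

(** A continuous linear form is bounded by a multiple of some [p n]. *)
Lemma coord_ker m : exists2 n, (1 <= n)%N & forall a, p n a = 0 -> iota a m = 0.
Proof.
have : nbhs (0 : A) [set a | `|iota a m| < 1].
  have /(@cvgrPdist_lt _ K^o) /(_ 1 ltr01) := fss_coord hA (m := m) (x := 0).
  by apply: filterS => a; rewrite coord0 sub0r normrN.
move=> /(ist_nbhs hp)[n [eps [n1 eps0 sub]]]; exists n => // a pa.
apply: contrapT => /eqP am.
have := sub ((iota a m)^-1 *: a).
rewrite /= subr0 (seminormZ (ist_seminorm hp n1)) pa mulr0.
by move=> /(_ eps0); rewrite coordZ mulVf // normr1 ltxx.
Qed.

(** By the chain condition, [tail_space m] modulo [ker (p n)] does not shrink
    any more from some [m = mu n] on.  A vector [a] of [tail_space (mu n)] can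
    thus be pushed into [tail_space (mu n.+1)], [tail_space (mu n.+2)], ... by
    successive corrections that [p n], [p n.+1], ... do not see.  The limit has
    all its coordinates zero, hence is [0], and [p n a = 0] follows. *)
Lemma ker_tail n : (1 <= n)%N -> exists m, forall a, tail_space iota m a -> p n a = 0.
Proof.
have chain n' : exists m0, (1 <= n')%N -> forall m a, tail_space iota m0 a ->
    exists2 u, tail_space iota m u & p n' (a - u) = 0.
  have [n1|] := leqP 1 n'; last by exists 0%N.
  have [d [v span]] := hker n1.
  have [| | | a _|m0 m0P] := subspace_chain_stationary (v := v)
    (T := [set a | p n' a = 0]) (U := tail_space iota).
  - exact: seminorm_ker_subspace (ist_seminorm hp n1).
  - exact: tail_subspace.
  - exact: tail_homo.
  - exact: span.
  - by exists m0 => _; apply: m0P.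
have [mu0 mu0P] := choice chain.
(* [n' <= mu n'] makes all the coordinates vanish in the limit. *)
pose mu n' := maxn (mu0 n') n'.
have step n' a : exists u, (1 <= n')%N -> tail_space iota (mu n') a ->
    tail_space iota (mu n'.+1) u /\ p n' (u - a) = 0.
  have [[n1 at_]|no] := pselect ((1 <= n')%N /\ tail_space iota (mu n') a); last first.
    by exists 0 => *; case: no.
  have [|u ? pu] := mu0P n' n1 (mu n'.+1) a.
    by apply: tail_homo at_; rewrite leq_maxl.
  by exists u; split=> //; rewrite (seminorm_distC (ist_seminorm hp n1)).
move=> n1; exists (mu n) => a ta.
have [g gP] := choice (fun na : nat * A => step na.1 na.2).
pose b j := iteri (j - n) (fun i u => g ((n + i)%N, u)) a.
have bS j : (n <= j)%N -> b j.+1 = g (j, b j).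
  by move=> nj; rewrite /b subSn //= subnKC.
have bt j : (n <= j)%N -> tail_space iota (mu j) (b j).
  move=> /subnKC <-; elim: (j - n)%N => [|i IH]; first by rewrite addn0 /b subnn.
  rewrite addnS bS ?leq_addr //.
  by case: (gP ((n + i)%N, b (n + i)%N)) => //=; apply: leq_trans (leq_addr _ _).
have [|l lP] := complete_ker_limit hp (u := b) (frechet_complete (fss_frechet hA)) n1.
  move=> j nj; rewrite bS //.
  by case: (gP (j, b j)) => //=; [apply: leq_trans nj|apply: bt].
have l0 : l = 0.
  apply: (coord_inj (fss_inj hA)) => m; rewrite coord0.
  have [n' n'1 n'P] := coord_ker m.
  pose j := maxn n (maxn n' m.+1).
  have nj : (n <= j)%N by rewrite leq_maxl.
  have n'j : (n' <= j)%N by rewrite leq_max leq_maxl orbT.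
  have mj : (m < j)%N by rewrite leq_max leq_maxr orbT.
  have := n'P _ (ist_ker hp n'1 n'j (lP j nj)); rewrite coordB.
  by rewrite (bt j) ?subr0 // leq_max mj orbT.
have := lP n (leqnn n); rewrite l0 sub0r (seminormN (ist_seminorm hp n1)).
by rewrite /b subnn.
Qed.

Lemma tail_cvg (u : nat -> A) a :
  (forall m, exists k0, forall k, (k0 <= k)%N -> tail_space iota m (u k - a)) ->
  u @ \oo --> a.
Proof.
move=> ut; apply/(ist_cvgP hp) => n eps n1 eps0.
have [m mP] := ker_tail n1; have [k0 k0P] := ut m.
by exists k0 => k /k0P/mP ->.
Qed.

Lemma coord_block_sum (s : nat -> K) i j k :
  iota (\sum_(i <= n < j) s n *: e n) k = if (i <= k < j)%N then s k else 0.
Proof.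
rewrite coord_sum (eq_bigr (fun n => if n == k then s n else 0)).
  by rewrite -big_mkcond big_nat1_eq.
move=> n _; rewrite coordZ (fss_basis hA) eq_sym.
by case: eqP; rewrite ?mulr1 ?mulr0.
Qed.

Lemma coord_partial_sum (s : nat -> K) n k :
  iota (partial_sum e n s) k = if (k <= n)%N then s k else 0.
Proof. exact: coord_block_sum. Qed.

Lemma partial_sum_cvg (nk : nat -> nat) a :
  (forall k, (k <= nk k)%N) ->
  partial_sum e (nk k) (iota a) @[k --> \oo] --> a.
Proof.
move=> nkk; apply: tail_cvg => m; exists m => k mk i im.
rewrite coordB coord_partial_sum ifT ?subrr //.
by apply: leq_trans (nkk k); apply: leq_trans mk; apply: ltnW.
Qed.

(** The series of the [s k *: e k] converges along any sequence of ranks that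
    outgrows those given by [ker_tail]. *)
Lemma coord_surj (s : nat -> K) : exists a, forall k, iota a k = s k.
Proof.
have kerE n : exists m, (1 <= n)%N -> forall a, tail_space iota m a -> p n a = 0.
  have [n1|] := leqP 1 n; last by exists 0%N.
  by have [m mP] := ker_tail n1; exists m.
have [mu muP] := choice kerE.
(* The successors make the rank exceed [j] as well as [mu j]. *)
pose b j := partial_sum e (\sum_(i < j.+1) (mu i).+1) s.
have mub j : (mu j < \sum_(i < j.+1) (mu i).+1)%N by rewrite big_ord_recr /= ltn_addl.
have jb j : (j < \sum_(i < j.+1) (mu i).+1)%N.
  elim: j => [|j IH]; rewrite big_ord_recr /= addnS ltnS //.
  by apply: leq_trans IH (leq_addr _ _).
have [|l lP] := complete_ker_limit hp (u := b) (frechet_complete (fss_frechet hA)) (leqnn 1).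
  move=> j j1; apply: (muP _ j1) => k kmu.
  rewrite coordB !coord_partial_sum !ifT ?subrr //.
    by apply/ltnW/(ltn_trans kmu).
  by rewrite big_ord_recr /=; apply/ltnW/(ltn_trans kmu)/ltn_addr.
exists l => k; have [n n1 nP] := coord_ker k.
pose j := maxn n k.
have j1 : (1 <= j)%N by rewrite leq_max n1.
have := nP _ (ist_ker hp n1 (leq_maxl n k) (lP j j1)); rewrite coordB => /eqP.
rewrite subr_eq0 coord_partial_sum => /eqP ->; rewrite ifT //.
by apply/ltnW/(leq_ltn_trans (leq_maxr n k)).
Qed.

End AllSequences.

(** * From spaceability to density *)

Lemma partial_sum_linear (K : numFieldType) (V : lmodType K) (x : nat -> V)
    (A : lmodType K) (iota : {linear A -> (nat -> K^o)}) n c u v :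
  partial_sum x n (iota (c *: u + v)) =
  c *: partial_sum x n (iota u) + partial_sum x n (iota v).
Proof.
rewrite /partial_sum scaler_sumr -big_split /=; apply: eq_bigr => i _.
by rewrite coordP scalerDl scalerA.
Qed.

Lemma partial_sum_tail (K : numFieldType) (V : lmodType K) (x : nat -> V)
    (A : lmodType K) (iota : {linear A -> (nat -> K^o)}) m n a :
  tail_space iota m a -> (n < m)%N -> partial_sum x n (iota a) = 0.
Proof.
move=> at_ nm; rewrite /partial_sum big_nat_cond big1 // => i /andP[/andP[_ ni] _].
by rewrite at_ ?scale0r //; apply: leq_trans nm.
Qed.

Lemma ltn_homo_ge (v : nat -> nat) : (forall k, (v k < v k.+1)%N) ->
  forall k, (k <= v k)%N.
Proof. by move=> vS; elim=> // k IH; apply: leq_ltn_trans IH (vS k). Qed.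

Lemma block_index (v : nat -> nat) n : (forall k, (v k < v k.+1)%N) ->
  (v 0 <= n)%N -> exists k, (v k <= n < v k.+1)%N.
Proof.
move=> vS v0n.
have exk : exists k, (n < v k)%N by exists n.+1; apply: ltn_homo_ge.
case: (ex_minnP exk) => -[|k]; first by rewrite ltnNge v0n.
move=> nk kmin; exists k; rewrite nk andbT leqNgt.
by apply/negP => /kmin; rewrite ltnn.
Qed.

(** Only finitely many lower bounds on the modulus of [c] are imposed, and the
    sum of these bounds is at least each of them; it replaces a maximum because
    the order of [K] may be partial. *)
Lemma large_multiplier (K : numFieldType) (V : lmodType K) (nu : V -> K)
    (B : nat) (a b : nat -> V) :
  seminorm nu -> (forall z, nu z = 0 -> z = 0) ->
  exists c, forall n, (n < B)%N -> b n != 0 -> 1 <= nu (c *: b n + a n).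
Proof.
move=> snu nu0; pose t n := (1 + nu (a n)) / nu (b n).
have t0 n : 0 <= t n by rewrite divr_ge0 ?addr_ge0 ?(seminorm_ge0 snu).
exists (\sum_(i < B) t i) => n nB bn0.
have bn : 0 < nu (b n).
  rewrite lt_def (seminorm_ge0 snu) andbT.
  by apply: contra_neq bn0; apply: nu0.
have le : 1 + nu (a n) <= nu ((\sum_(i < B) t i) *: b n).
  rewrite (seminormZ snu) ger0_norm ?sumr_ge0 // -ler_pdivrMr //.
  by rewrite (bigD1 (Ordinal nB)) //= lerDl sumr_ge0.
rewrite -(lerD2r (nu (a n))); apply: (le_trans le).
rewrite -[X in nu X <= _](addrK (a n)) -(seminormN snu (a n)).
exact: (seminormD snu).
Qed.

Section Necessity.
Variables (K : numFieldType) (A : topologicalLmodType K).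
Variables (iota : {linear A -> (nat -> K^o)}) (e : nat -> A).
Hypothesis hA : frechet_sequence_space iota e.
Variable p : nat -> A -> K.
Hypothesis hp : increasing_seminorms_topology p.
Hypothesis hker : forall n, (1 <= n)%N -> finite_codim [set a : A | p n a = 0].
Variables (X : topologicalLmodType K) (x : nat -> X).

(** If the partial sums of every element [f] of [W `&` tail_space N] other than
    [0] were eventually nonzero, one could choose ranks [v k] and
    [f k \in W `&` tail_space (v k)] with [S n (f k) != 0] for [v k.+1 <= n].
    For [n < v k.+2], the partial sum of [h = \sum_k c k *: f k] only involves
    [f 0], ..., [f k.+1]; the scalar [c k] is taken so large, given the
    previous ones, that [1 <= nu (S n (\sum_(i <= k) c i *: f i))] for all
    [n < v k.+2] such that [S n (f k) != 0].  When
    [v k.+1 <= n < v k.+2], the last term met, [f k.+1], can have a zero partial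
    sum of index [n], but [f k] cannot, which yields [1 <= nu (S n h)] anyway. *)
Lemma recurrent_zero_partial_sums (nu : X -> K) (W : set A) (N : nat) :
  seminorm nu -> (forall z, nu z = 0 -> z = 0) ->
  linear_subspace W -> closed W -> ~ finite_dim W ->
  (forall f, W f -> f != 0 -> forall m, exists2 n, (m <= n)%N &
    nu (partial_sum x n (iota f)) < 1) ->
  exists f, [/\ W f, tail_space iota N f, f != 0 & forall m, exists2 n, (m <= n)%N &
    partial_sum x n (iota f) = 0].
Proof.
move=> snu nu0 Wsub Wclosed Winf small.
pose S n f := partial_sum x n (iota f).
apply: contrapT => nex.
have gex m : exists ft : A * nat, [/\ W ft.1, tail_space iota m ft.1 &
    forall n, (ft.2 <= n)%N -> S n ft.1 != 0].
  have [f [Wf ft f0]] : exists f, [/\ W f, tail_space iota (maxn m N) f & f != 0].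
    apply: contrapT => nf; apply: Winf.
    apply/(finite_dim_tailP (fss_inj hA) Wsub); exists (maxn m N) => z [Wz tz] /=.
    by apply: contrapT => /eqP z0; apply: nf; exists z.
  apply: contrapT => nt; apply: nex; exists f; split=> //.
    by apply: tail_homo ft; apply: leq_maxr.
  move=> m'; apply: contrapT => nn; apply: nt; exists (f, m'); split=> //=.
    by apply: tail_homo ft; apply: leq_maxl.
  by move=> n m'n; apply/eqP => Sn; apply: nn; exists n.
have [g gP] := choice gex.
pose v k := iter k (fun m => maxn (g m).2 m.+1) 0%N.
have vS k : (v k < v k.+1)%N by rewrite /= leq_maxr.
have v_homo : {homo v : i j / (i <= j)%N}.
  by apply: homo_leq => //; [apply: leq_trans|move=> k; apply: ltnW].
pose f k := (g (v k)).1.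
have Wf k : W (f k) by case: (gP (v k)).
have tf k : tail_space iota (v k) (f k) by case: (gP (v k)).
have Sf k n : (v k.+1 <= n)%N -> S n (f k) != 0.
  move=> vn; case: (gP (v k)) => _ _; apply.
  by apply: leq_trans vn; apply: leq_maxl.
have cex (ku : nat * A) :=
  large_multiplier (v ku.1.+2) (S^~ ku.2) (S^~ (f ku.1)) snu nu0.
have [c cP] := choice cex.
pose F k := iteri k (fun i u => c (i, u) *: f i + u) 0.
have FS k : F k.+1 = c (k, F k) *: f k + F k by [].
have WF k : W (F k) by elim: k => [|k IH]; [case: Wsub|rewrite FS; apply: Wsub.2].
have tF i j : (i <= j)%N -> tail_space iota (v i) (F j - F i).
  move=> /subnKC <-; elim: (j - i)%N => [|d IH].
    by rewrite addn0 subrr; case: (tail_subspace iota (v i)).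
  rewrite addnS FS -addrA; apply: (tail_subspace iota (v i)).2 => //.
  by apply: tail_homo (tf _); apply/v_homo/leq_addr.
(* The [k]-th coordinate of [F j] is constant for [k < j], as [k < v k.+1]. *)
have [h hE] := coord_surj hA hp hker (fun k => iota (F k.+1) k).
have th k : tail_space iota (v k) (h - F k).
  move=> m mv; rewrite coordB hE -coordB; case: (leqP k m.+1) => km; first exact: tF.
  rewrite -opprB -scaleN1r coordZ (tF _ _ (ltnW km)) ?mulr0 //.
  by apply: ltn_homo_ge.
have Wh : W h.
  apply: (closed_cvg _ Wclosed _ _ (_ : F @ \oo --> h)); first exact: nearW.
  apply: (tail_cvg hA hp hker) => m; exists m => k mk.
  rewrite -opprB -scaleN1r; apply: (subspaceZ (tail_subspace iota m)).
  by apply: tail_homo (th k); apply: leq_trans mk _; apply: ltn_homo_ge.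
have big n : (v 1 <= n)%N -> 1 <= nu (S n h).
  move=> v1n; have [k /andP[kn nk]] := @block_index (fun k => v k.+1) n (fun k => vS k.+1) v1n.
  have -> : S n h = S n (F k.+2).
    rewrite -[h](subrK (F k.+2)) -[h - _]scale1r /S partial_sum_linear.
    by rewrite (partial_sum_tail _ (th k.+2) nk) scaler0 add0r.
  (* If [f k.+1] contributes nothing, the choice of [c k] gives the bound. *)
  have [Sf0|Sf0] := eqVneq (S n (f k.+1)) 0.
    rewrite FS /S partial_sum_linear -/(S n (f k.+1)) Sf0 scaler0 add0r.
    by rewrite FS partial_sum_linear; apply: (cP (k, F k)) => //; apply: Sf.
  rewrite FS /S partial_sum_linear; apply: (cP (k.+1, F k.+1)) => //.
  exact: ltn_trans nk (vS _).
have h0 : h != 0.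
  apply/eqP => h0; have := big _ (leqnn _).
  rewrite h0 /S /partial_sum big1 => [|i _]; last by rewrite coord0 scale0r.
  by rewrite (seminorm0 snu) ler10.
have [n /big nbig] := small h Wh h0 (v 1).
by move=> /(le_lt_trans nbig); rewrite ltxx.
Qed.

Lemma restricted_universal_recurrent f : restricted_universal iota e x f ->
  forall (y : X) U, nbhs y U -> forall m, exists2 n, (m <= n)%N &
    U (partial_sum x n (iota f)).
Proof.
move=> fU y U yU m; have [nk [_ nk_homo cx _]] := fU y.
have [k0 _ k0P] := cx _ yU; exists (nk (maxn k0 m)).
  apply: leq_trans (leq_maxr k0 m) _.
  by apply: ltn_homo_ge => k; apply: nk_homo.
by apply: k0P; apply: leq_maxl.
Qed.

(** The element [f] starts so late that [p N] vanishes on each of its blocks.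
    With [S_M f] in the open set and [S_L f = 0], the two blocks are the
    coefficients of [f] up to [M], and those of [- f] from [M.+1] to [L]. *)
Lemma spaceable_dense_block_sums N eps :
  has_continuous_norm X -> (1 <= N)%N -> 0 < eps ->
  spaceable (restricted_universal iota e x) ->
  dense (\bigcup_(M in [set M | (N <= M)%N])
         \bigcup_(L in [set L | (M < L)%N])
           (block_sums e x (p N) eps N M `&`
            block_sums e x (p N) eps M.+1 L)).
Proof.
move=> [nu [snu nu0 nu_cont]] N1 eps0 [W [/submod_closedP Wsub Wclosed Winf WU]].
have rec f : W f -> f != 0 -> forall (y : X) U, nbhs y U -> forall m,
    exists2 n, (m <= n)%N & U (partial_sum x n (iota f)).
  move=> Wf f0; case: (WU f Wf) => [/restricted_universal_recurrent//|/eqP].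
  by rewrite (negbTE f0).
have [m0 m0P] := ker_tail hA hp hker N1.
have [|f [Wf ft f0 fzero]] :=
  recurrent_zero_partial_sums (maxn N m0) snu nu0 Wsub Wclosed Winf.
  move=> f Wf f0; apply: (rec f Wf f0 0 [set z | nu z < 1]).
  have /(@cvgrPdist_lt _ K^o) /(_ 1 ltr01) := nu_cont 0.
  apply: filterS => z; rewrite (seminorm0 snu) sub0r normrN.
  by rewrite ger0_norm // (seminorm_ge0 snu).
have fN k : (k < N)%N -> iota f k = 0 by move=> kN; apply: ft; rewrite leq_max kN.
move=> O [y Oy] Oopen.
have [M NM OM] := rec f Wf f0 y O (open_nbhs_nbhs (conj Oopen Oy)) N.
have [L ML SL] := fzero M.+1.
exists (partial_sum x M (iota f)); split=> //; exists M => //; exists L => //; split.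
  exists (iota f).
    rewrite /= m0P // => k km; rewrite (coord_block_sum hA) ft ?if_same //.
    by rewrite leq_max km orbT.
  rewrite /partial_sum [RHS](@big_cat_nat _ _ _ N) //=; last exact: leqW.
  rewrite big_nat_cond [in RHS]big_nat_cond [X in _ = X + _]big1 ?add0r -?big_nat_cond //.
  by move=> i /andP[/andP[_ /fN ->] _]; rewrite scale0r.
exists (fun k => - iota f k).
  rewrite /= m0P // => k km; rewrite (coord_block_sum hA) ft ?oppr0 ?if_same //.
  by rewrite leq_max km orbT.
under eq_bigr do rewrite scaleNr.
rewrite sumrN; apply/esym/eqP; rewrite -subr_eq0 opprK; apply/eqP.
by rewrite -[RHS]SL /partial_sum [RHS](@big_cat_nat _ _ _ M.+1) //=; apply: leqW.
Qed.

End Necessity.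

(** * From density to spaceability *)

Lemma real_or_complex_archimedean (R : realType) (K : numFieldType) :
  real_or_complex R K -> forall eps : K, 0 < eps ->
  exists k, (k.+1%:R : K)^-1 < eps.
Proof.
case=> [|] eps eps0; first by have [k] := ltr_add_invr eps0; rewrite add0r; exists k.
case: eps eps0 => a b; rewrite ltcE /= => /andP[/eqP -> a0].
have [k ka] := ltr_add_invr a0; exists k; rewrite add0r in ka.
by rewrite -(rmorph_nat (real_complex R)) -fmorphV /= -[(a +i* 0)%C]/(a%:C)%C ltcR.
Qed.

(** The exponents of [2], [3] and [5] enumerate the triples of natural numbers
    with infinitely many repetitions, the exponent of [7] being free. *)
Lemma exists_stage i l k m : exists s,
  [/\ (m <= s)%N, logn 2 s = i, logn 3 s = l & logn 5 s = k].
Proof.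
exists (2 ^ i * 3 ^ l * 5 ^ k * 7 ^ m)%N.
have lognE r : logn r (2 ^ i * 3 ^ l * 5 ^ k * 7 ^ m) =
    (i * logn r 2 + l * logn r 3 + k * logn r 5 + m * logn r 7)%N.
  by rewrite !lognM ?muln_gt0 ?expn_gt0 // !lognX.
split; try by rewrite lognE !logn_prime //= !muln0 muln1 ?addn0.
apply: (leq_trans (ltnW (ltn_expl m (isT : (1 < 7)%N)))).
by rewrite leq_pmull // !muln_gt0 !expn_gt0.
Qed.

Section Sufficiency.
Variables (R : realType) (K : numFieldType).
Hypothesis hK : real_or_complex R K.
Variables (X : topologicalLmodType K) (q : nat -> X -> K).
Hypothesis hq : increasing_seminorms_topology q.

(** Balls of radius [1 / (k + 1)] around the terms of a dense sequence.  As
    countably many targets to be visited they serve every point of [X] and,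
    through [nbhs_scale], they still do so after multiplication by a nonzero
    scalar. *)
Lemma countable_pi_base : separable_space X ->
  exists (y : nat -> X) (B : nat -> nat -> set X),
    (forall l k, nbhs (y l) (B l k)) /\
    (forall (z : X) U, nbhs z U -> exists l k, B l k `<=` U).
Proof.
move=> [D /countable_injP[f finj] Ddense].
have enum l : exists w, (exists2 z, D z & f z = l) -> D w /\ f w = l.
  have [[z Dz fz]|no] := pselect (exists2 z, D z & f z = l); last by exists 0.
  by exists z.
have [y yP] := choice enum.
exists y, (fun l k => [set w | q k.+1 (w - y l) < k.+1%:R^-1]); split=> [l k|z U].
  by apply/(ist_nbhs hq); exists k.+1, k.+1%:R^-1; split; rewrite ?invr_gt0.
move=> /(ist_nbhs hq)[j [eps [j1 eps0 sub]]].
have eps2 : 0 < eps / 2 by rewrite divr_gt0.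
have [k0 k0P] := real_or_complex_archimedean hK eps2.
have : nbhs z [set w | q j (w - z) < eps / 2].
  by apply/(ist_nbhs hq); exists j, (eps / 2); split.
rewrite nbhsE => -[G [Gopen Gz] Gsub].
have [d [Gd Dd]] := Ddense G (ex_intro _ z Gz) Gopen.
have [Dy fy] := yP (f d) (ex_intro2 _ _ d Dd erefl).
have yd : y (f d) = d by apply: finj; rewrite ?in_setE.
exists (f d), (maxn j k0); move=> w /=; rewrite yd => wd; apply: sub => /=.
apply: (le_lt_trans (seminorm_dist_triangle (ist_seminorm hq j1) d _ _)).
rewrite [eps]splitr; apply: ltrD; last exact: Gsub.
apply: (le_lt_trans (ist_homo hq _ j1 (leqW (leq_maxl j k0)))).
apply: (lt_trans wd); apply: le_lt_trans k0P.
by rewrite lef_pV2 ?posrE // ler_nat ltnS leq_maxr.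
Qed.

Lemma recurrent_restricted_universal (A : topologicalLmodType K)
    (iota : {linear A -> (nat -> K^o)}) (e : nat -> A) (x : nat -> X) f :
  (forall nk : nat -> nat, (forall k, (k <= nk k)%N) ->
    partial_sum e (nk k) (iota f) @[k --> \oo] --> f) ->
  (forall (y : X) U, nbhs y U -> forall m, exists2 n, (m <= n)%N &
    U (partial_sum x n (iota f))) ->
  restricted_universal iota e x f.
Proof.
move=> cve rec y.
have next (km : nat * nat) : exists n, (km.2 <= n)%N /\
    q km.1.+1 (partial_sum x n (iota f) - y) < km.1.+1%:R^-1.
  have [|n] := rec y [set w | q km.1.+1 (w - y) < km.1.+1%:R^-1] _ km.2.
    by apply/(ist_nbhs hq); exists km.1.+1, km.1.+1%:R^-1; split; rewrite ?invr_gt0.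
  by exists n.
have [g gP] := choice next.
pose nk k := iteri k (fun i n => g (i.+1, n.+1)) (g (0%N, 1%N)).
have nkS k : (nk k < nk k.+1)%N by case: (gP (k.+1, (nk k).+1)).
have nkP k : q k.+1 (partial_sum x (nk k) (iota f) - y) < k.+1%:R^-1.
  by case: k => [|k]; [case: (gP (0%N, 1%N))|case: (gP (k.+1, (nk k).+1))].
exists nk; split.
- case=> [|k]; first by case: (gP (0%N, 1%N)).
  by apply: leq_ltn_trans (nkS k).
- exact: homo_ltn ltn_trans nkS.
- apply/(ist_cvgP hq) => j eps j1 /(real_or_complex_archimedean hK)[k0 k0P].
  exists (maxn j k0) => k; rewrite geq_max => /andP[jk k0k].
  apply: (le_lt_trans (ist_homo hq _ j1 (leqW jk))).
  apply: (lt_trans (nkP k)); apply: le_lt_trans k0P.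
  by rewrite lef_pV2 ?posrE // ler_nat ltnS.
- by apply: cve => k; apply: ltn_homo_ge.
Qed.

Lemma nbhs_scale c (y : X) U : c != 0 -> nbhs y U ->
  nbhs (c^-1 *: y) [set w | U (c *: w)].
Proof.
move=> c0 /(ist_nbhs hq)[j [eps [j1 eps0 sub]]].
have c0' : 0 < `|c| by rewrite normr_gt0.
apply/(ist_nbhs hq); exists j, (eps / `|c|); split=> //; first exact: divr_gt0.
move=> w /= wlt; apply: sub => /=.
rewrite (_ : _ - _ = c *: (w - c^-1 *: y)); last first.
  by rewrite scalerBr scalerA divff // scale1r.
by rewrite (seminormZ (ist_seminorm hq j1)) mulrC -ltr_pdivlMr.
Qed.

(** Stage [s] works on the indices between [N s] and [N s.+1 - 1]: its block of
    coefficients takes the partial sums from [0] into the target coded by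
    [logn 3 s] and [logn 5 s], and then back to [0].  It is owned by [logn 2 s].
    Multiplying each block by a scalar that depends only on its owner preserves
    the returns to [0], so that during a stage of owner [i] the partial sums
    are those of the block, multiplied by [c i]. *)
Lemma interleaved_blocks (x : nat -> X) : separable_space X ->
  (forall n0 (y : X) U, (1 <= n0)%N -> nbhs y U ->
    exists (h : nat -> K) (M L : nat), [/\ (n0 <= M < L)%N,
      U (\sum_(n0 <= k < M.+1) h k *: x k) &
      \sum_(n0 <= k < L.+1) h k *: x k = 0]) ->
  exists (own : nat -> nat) (b : nat -> K), (forall n, (own n <= n)%N) /\
    forall (c a : nat -> K) i, c i != 0 -> (forall n, a n = c (own n) * b n) ->
      forall (y : X) U, nbhs y U -> forall m, exists2 n, (m <= n)%N &
        U (partial_sum x n a).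
Proof.
move=> sepX blocks; have [y0 [B [yB Bbase]]] := countable_pi_base sepX.
have stage (sn : nat * nat) : exists t : (nat -> K) * (nat * nat), (1 <= sn.2)%N ->
    [/\ (sn.2 <= t.2.1 < t.2.2)%N,
      B (logn 3 sn.1) (logn 5 sn.1) (\sum_(sn.2 <= k < t.2.1.+1) t.1 k *: x k) &
      \sum_(sn.2 <= k < t.2.2.+1) t.1 k *: x k = 0].
  have [n1|] := leqP 1 sn.2; last by exists (fun=> 0, (0%N, 0%N)).
  have [h [M [L hML]]] := blocks _ _ _ n1 (yB (logn 3 sn.1) (logn 5 sn.1)).
  by exists (h, (M, L)).
have [t tP] := choice stage.
pose N s := iteri s (fun i n => (t (i, n)).2.2.+1) 1%N.
pose M s := (t (s, N s)).2.1.
pose L s := (t (s, N s)).2.2.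
pose h s := (t (s, N s)).1.
have NSE s : N s.+1 = (L s).+1 by [].
have N1 s : (1 <= N s)%N by case: s.
have NM s : (N s <= M s)%N by case: (tP (s, N s) (N1 s)) => /andP[].
have ML s : (M s < L s)%N by case: (tP (s, N s) (N1 s)) => /andP[].
have hM s : B (logn 3 s) (logn 5 s) (\sum_(N s <= k < (M s).+1) h s k *: x k).
  by case: (tP (s, N s) (N1 s)).
have hL s : \sum_(N s <= k < N s.+1) h s k *: x k = 0.
  by case: (tP (s, N s) (N1 s)).
have NS s : (N s < N s.+1)%N.
  by rewrite NSE ltnS; apply: leq_trans (NM s) (ltnW (ML s)).
have N_homo : {homo N : s s' / (s <= s')%N}.
  by apply: homo_leq => //; [apply: leq_trans|move=> k; apply: ltnW].
have blkex n : exists s, if n is 0%N then s = 0%N else (N s <= n < N s.+1)%N.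
  by case: n => [|n]; [exists 0%N|apply: block_index].
have [blk blkP] := choice blkex.
have blkE s n : (N s <= n < N s.+1)%N -> blk n = s.
  move=> /andP[sn ns]; case: n sn ns (blkP n) => [|n] sn ns.
    by have := leq_trans (N1 s) sn.
  move=> /andP[tn nt]; case: (ltngtP (blk n.+1) s) => // /N_homo le.
    by have := leq_trans le sn; rewrite leqNgt nt.
  by have := leq_trans le tn; rewrite leqNgt ns.
have blk_le n : (blk n <= n)%N.
  case: n (blkP n) => [->//|n /andP[Nn _]].
  by apply: leq_trans Nn; apply: ltn_homo_ge.
exists (logn 2 \o blk), (fun n => if n is 0%N then 0 else h (blk n) n).
split=> [n /=|c a i ci aE y U yU m].
  apply: leq_trans (blk_le n); case: (blk n) => [|s]; first by rewrite logn0.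
  by apply/ltnW; apply: ltn_logl.
have aN s n : (N s <= n < N s.+1)%N -> a n = c (logn 2 s) * h s n.
  move=> sn; rewrite aE /= (blkE s) //; case: n sn => // /andP[].
  by rewrite leqNgt N1.
have zero s : \sum_(0 <= k < N s) a k *: x k = 0.
  elim: s => [|s IH]; first by rewrite big_nat1 aE mulr0 scale0r.
  rewrite (@big_cat_nat _ _ _ (N s)) //=; last exact: ltnW.
  rewrite IH add0r big_nat (eq_bigr (fun k => c (logn 2 s) *: (h s k *: x k))).
    by rewrite -big_nat -scaler_sumr hL scaler0.
  by move=> k /aN ->; rewrite scalerA.
have [l [k lkU]] := Bbase _ _ (nbhs_scale ci yU).
have [s [ms si sl sk]] := exists_stage i l k m.
exists (M s).
  apply: leq_trans (NM s); apply: leq_trans ms _; exact: ltn_homo_ge.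
rewrite /partial_sum (@big_cat_nat _ _ _ (N s)) //=; last exact: leqW.
rewrite zero add0r big_nat (eq_bigr (fun k => c i *: (h s k *: x k))).
  by rewrite -big_nat -scaler_sumr; apply: lkU; rewrite -sl -sk.
move=> k' /andP[Nk kM]; rewrite (aN s) ?si ?scalerA // Nk NSE /=.
by apply: leq_trans kM _; apply/leqW/ML.
Qed.

End Sufficiency.

(** Two consecutive blocks with the same sum, the second one taken with the
    opposite sign, form a single block of sum [0]. *)
Lemma dense_block_sums_return (K : numFieldType) (A X : topologicalLmodType K)
    (e : nat -> A) (p : nat -> A -> K) (x : nat -> X) :
  (forall (N : nat) (eps : K), (1 <= N)%N -> 0 < eps ->
    dense (\bigcup_(M in [set M | (N <= M)%N])
           \bigcup_(L in [set L | (M < L)%N])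
             (block_sums e x (p N) eps N M `&`
              block_sums e x (p N) eps M.+1 L))) ->
  forall N (y : X) U, (1 <= N)%N -> nbhs y U ->
    exists (h : nat -> K) (M L : nat), [/\ (N <= M < L)%N,
      U (\sum_(N <= k < M.+1) h k *: x k) &
      \sum_(N <= k < L.+1) h k *: x k = 0].
Proof.
move=> dense_sums N y U N1; rewrite nbhsE => -[G [Gopen Gy] GU].
have [z [Gz [M NM [L ML [[a _ az] [a' _ a'z]]]]]] :=
  dense_sums N 1 N1 ltr01 G (ex_intro _ y Gy) Gopen.
pose h k := if (k <= M)%N then a k else - a' k.
have hM : \sum_(N <= k < M.+1) h k *: x k = z.
  rewrite -az; apply: eq_big_nat => k /andP[_ kM].
  by rewrite /h -ltnS kM.
exists h, M, L; split; [by apply/andP|by rewrite hM; apply: GU|].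
rewrite (@big_cat_nat _ _ _ M.+1) //=; [|exact: leqW|exact: leqW].
rewrite hM (_ : \sum_(M.+1 <= k < L.+1) h k *: x k = - z) ?subrr //.
rewrite -a'z -sumrN; apply: eq_big_nat => k /andP[Mk _].
by rewrite /h leqNgt Mk scaleNr.
Qed.

Lemma closed_coord_relation (K : numFieldType) (A : topologicalLmodType K)
    (iota : {linear A -> (nat -> K^o)}) (n m : nat) (r s : K) :
  (forall k, continuous (fun a : A => iota a k : K^o)) ->
  closed [set a | iota a n * r = iota a m * s].
Proof.
move=> coord_cont.
pose g (a : A) : K^o := (iota a n : K^o) * r - (iota a m : K^o) * s.
have gcont : continuous g.
  by move=> a; apply: (@cvgB K K^o); apply: (@cvgMr_tmp K); apply: coord_cont.
have -> : [set a | iota a n * r = iota a m * s] = g @^-1` [set 0].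
  rewrite eqEsubset; split=> a /=; first by rewrite /g => ->; rewrite subrr.
  by move=> /eqP; rewrite subr_eq0 => /eqP.
apply: (continuous_closedP g).1 => //.
exact/accessible_closed_set1/hausdorff_accessible/norm_hausdorff.
Qed.

Theorem corollary4p6 (R : realType) (K : numFieldType)
  (hK : real_or_complex R K)
  (A : topologicalLmodType K) (iota : {linear A -> (nat -> K^o)})
  (e : nat -> A) (hA : frechet_sequence_space iota e)
  (p : nat -> A -> K) (hp : increasing_seminorms_topology p)
  (X : topologicalLmodType K) (hX : separable_space X)
  (q : nat -> X -> K) (hq : increasing_seminorms_topology q)
  (x : nat -> X)
  (hXnorm : has_continuous_norm X)
  (hker : forall n, (1 <= n)%N -> finite_codim [set a : A | p n a = 0]) :
  spaceable (restricted_universal iota e x) <->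
  (forall (N : nat) (eps : K), (1 <= N)%N -> 0 < eps ->
    dense (\bigcup_(M in [set M | (N <= M)%N])
           \bigcup_(L in [set L | (M < L)%N])
             (block_sums e x (p N) eps N M `&`
              block_sums e x (p N) eps M.+1 L))).
Proof.
split=> [spc N eps N1 eps0|dense_sums].
  exact: (spaceable_dense_block_sums hA hp hker).
have universal f : (forall (y : X) U, nbhs y U -> forall m, exists2 n, (m <= n)%N &
    U (partial_sum x n (iota f))) -> restricted_universal iota e x f.
  apply: (recurrent_restricted_universal hK hq) => nk nkk.
  exact: (partial_sum_cvg hA hp hker).
have [X0|/existsNP[z /eqP z0]] := pselect (forall z : X, z = 0).
  have T_sub : linear_subspace [set: A] by [].
  exists setT; split.
  - exact/submod_closedP.
  - exact: closedT.
  - move=> /(finite_dim_tailP (fss_inj hA) T_sub)[m mP].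
    have em : [set 0] (e m).
      apply: mP; split=> // k km.
      by rewrite (fss_basis hA) (ltn_eqF km).
    have := fss_basis hA m m; rewrite em coord0 eqxx => /esym/eqP.
    by rewrite oner_eq0.
  move=> f _; left; apply: universal => y U yU m; exists m => //.
  by rewrite (X0 (partial_sum _ _ _)) -(X0 y); apply: nbhs_singleton.
have [own [b [own_le rec]]] :=
  interleaved_blocks hK hq hX (dense_block_sums_return dense_sums).
(* A zero [b] on the indices of owner [i] would make [0] universal. *)
have bnz i : exists2 n, own n = i & b n != 0.
  apply: contrapT => nob; have [nu [snu nu0 nu_cont]] := hXnorm.
  have zU : nbhs z [set w | w != 0].
    have : 0 < nu z.
      by rewrite lt_def (seminorm_ge0 snu) andbT; apply: contra_neq z0; apply: nu0.
    have := nu_cont z; move=> /(@cvgrPdist_lt _ K^o) h /h.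
    apply: filterS => w /=; apply: contraTneq => ->.
    by rewrite (seminorm0 snu) subr0 ger0_norm ?ltxx // (seminorm_ge0 snu).
  have [|n|n _ /=] := rec (fun j => (j == i)%:R) (fun=> 0) i _ _ z _ zU 0%N.
  - by rewrite eqxx oner_neq0.
  - case: eqP => [oi|]; last by rewrite mul0r.
    rewrite mul1r; apply/esym/eqP; apply: contra_notT nob => bn.
    by exists n.
  - by rewrite /partial_sum big1 ?eqxx // => k _; rewrite scale0r.
(* This is the set of the sequences [c (own n) * b n], because of [bnz], in a
   form that shows that it is closed. *)
pose W := [set a | forall n m, own n = own m -> iota a n * b m = iota a m * b n].
have Wsub : linear_subspace W.
  split=> [n m _|c u v Wu Wv n m nm]; first by rewrite !coord0 !mul0r.
  by rewrite !coordP !mulrDl -!mulrA Wu // Wv.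
exists W; split.
- exact/submod_closedP.
- have -> : W = \bigcap_(nm in [set nm : nat * nat | own nm.1 = own nm.2])
      [set a | iota a nm.1 * b nm.2 = iota a nm.2 * b nm.1].
    rewrite eqEsubset; split=> a; first by move=> Wa [n m] /=; apply: Wa.
    by move=> Wa n m nm; apply: (Wa (n, m)).
  apply: closed_bigI => nm _.
  exact/closed_coord_relation/(fss_coord hA).
- move=> /(finite_dim_tailP (fss_inj hA) Wsub)[i iP].
  have [a aE] := coord_surj hA hp hker (fun n => (own n == i)%:R * b n).
  have [n ni bn] := bnz i.
  have a0 : [set 0] a.
    apply: iP; split=> [n' m nm|k ki]; first by rewrite !aE nm mulrAC.
    have := leq_ltn_trans (own_le k) ki.
    by rewrite aE ltn_neqAle => /andP[/negbTE -> _]; rewrite mul0r.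
  have := aE n; rewrite a0 coord0 ni eqxx mul1r => /esym/eqP.
  by rewrite (negbTE bn).
move=> a Wa; have [->|a0] := eqVneq a 0; [by right|left].
have [n0 an0] : exists n, iota a n != 0.
  apply: contrapT => nex; move/eqP: a0; apply; apply: (coord_inj (fss_inj hA)) => n.
  by rewrite coord0; apply: contrapT => /eqP an; apply: nex; exists n.
have repr i : exists n, own n = i /\ b n != 0 by have [n] := bnz i; exists n.
have [r rP] := choice repr.
pose c i := iota a (r i) / b (r i).
have aE n : iota a n = c (own n) * b n.
  have [ro br] := rP (own n).
  by rewrite mulrAC -(Wa n (r (own n))) ?ro // mulfK.
apply: universal; apply: (rec c _ (own n0)) => //.
by apply: contra_neq an0 => c0; rewrite aE c0 mul0r.
Qed.
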